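(* The logic $\mathbf{Diff}\times^{sq}\mathbf{Diff}$ is not axiomatisable over $\mathbf{Diff}\times\mathbf{Diff}$ using finitely many propositional variables; that is, there is no set $\Sigma$ of bimodal formulas containing altogether only finitely many distinct propositional variables such that $\mathbf{Diff}\times^{sq}\mathbf{Diff}$ is the smallest normal bimodal logic containing $(\mathbf{Diff}\times\mathbf{Diff})\cup\Sigma$.
   Context: Bimodal formulas are built from propositional variables, $\top,\bot,\neg,\wedge,\vee$ and $\Box_h,\Box_v,\Diamond_h,\Diamond_v$, evaluated in frames $(W,R_h,R_v)$ as usual. A normal bimodal logic is a set of formulas containing all tautologies and $\Box_i(p\to q)\to(\Box_ip\to\Box_iq)$ ($i=h,v$), closed under substitution, modus ponens and necessitation for both boxes; the logic of a class of frames is the set of formulas valid in all its members. For a nonempty set $U$, $\neq_U$ denotes inequality on $U$. The product of unimodal frames $(U,R)$ and $(V,S)$ is the bimodal frame $(U\times V,\bar R_h,\bar R_v)$ with $(x,y)\bar R_h(x',y')$ iff $xRx'$ and $y=y'$, and $(x,y)\bar R_v(x',y')$ iff $ySy'$ and $x=x'$. $\mathbf{Diff}\times\mathbf{Diff}$ is the logic of all products $(U,\neq_U)\times(V,\neq_V)$ of difference frames ($U,V$ nonempty sets), and $\mathbf{Diff}\times^{sq}\mathbf{Diff}$ is the logic of all such products with $|U|=|V|$. *)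

(* Defs.v *)
From mathcomp Require Import all_boot.
From mathcomp Require Import boolp classical_sets functions cardinality.

Set Implicit Arguments.
Unset Strict Implicit.
Unset Printing Implicit Defensive.

Local Open Scope classical_set_scope.
Local Open Scope card_scope.

Inductive modality := Hor | Ver.

(* Boxes and diamonds are both primitive, as are conjunction and disjunction;
   implication is the usual abbreviation. *)
Inductive form :=
| Var of nat
| Top
| Bot
| Neg of form
| And of form & form
| Or of form & form
| Box of modality & form
| Dia of modality & form.

Definition Imp (f g : form) : form := Or (Neg f) g.

Fixpoint vars (f : form) : set nat :=
  match f with
  | Var p => [set p]
  | Top | Bot => set0
  | Neg g | Box _ g | Dia _ g => vars g
  | And g h | Or g h => vars g `|` vars h
  end.

Fixpoint subst (s : nat -> form) (f : form) : form :=
  match f with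
  | Var p => s p
  | Top => Top
  | Bot => Bot
  | Neg g => Neg (subst s g)
  | And g h => And (subst s g) (subst s h)
  | Or g h => Or (subst s g) (subst s h)
  | Box i g => Box i (subst s g)
  | Dia i g => Dia i (subst s g)
  end.

(* Truth-functional evaluation: formulas headed by a modal operator are treated
   as atoms, to which [a] assigns arbitrary truth values. *)
Fixpoint prop_eval (a : form -> bool) (f : form) : bool :=
  match f with
  | Top => true
  | Bot => false
  | Neg g => ~~ prop_eval a g
  | And g h => prop_eval a g && prop_eval a h
  | Or g h => prop_eval a g || prop_eval a h
  | Var _ | Box _ _ | Dia _ _ => a f
  end.

Definition tautology (f : form) : Prop := forall a, prop_eval a f.

Record normal_logic (L : set form) : Prop := NormalLogic {
  normal_taut : forall f, tautology f -> L f;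
  normal_K : forall i p q,
    L (Imp (Box i (Imp (Var p) (Var q)))
           (Imp (Box i (Var p)) (Box i (Var q))));
  normal_subst : forall s f, L f -> L (subst s f);
  normal_mp : forall f g, L f -> L (Imp f g) -> L g;
  normal_nec : forall i f, L f -> L (Box i f)
}.

Record unimodal_frame := UnimodalFrame {
  point :> Type;
  acc : point -> point -> Prop
}.

Record bimodal_frame := BimodalFrame {
  world :> Type;
  bacc : modality -> world -> world -> Prop
}.

Fixpoint sat (F : bimodal_frame) (V : nat -> set F) (f : form) (w : F) : Prop :=
  match f with
  | Var p => V p w
  | Top => True
  | Bot => False
  | Neg g => ~ sat V g w
  | And g h => sat V g w /\ sat V h w
  | Or g h => sat V g w \/ sat V h w
  | Box i g => forall w', bacc i w w' -> sat V g w'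
  | Dia i g => exists2 w', bacc i w w' & sat V g w'
  end.

Definition valid (F : bimodal_frame) (f : form) : Prop :=
  forall (V : nat -> set F) (w : F), sat V f w.

Definition logic_of (C : set bimodal_frame) : set form :=
  [set f | forall F, C F -> valid F f].

Definition product_frame (F G : unimodal_frame) : bimodal_frame :=
  @BimodalFrame (F * G)%type (fun i w w' =>
    match i with
    | Hor => acc w.1 w'.1 /\ w.2 = w'.2
    | Ver => acc w.2 w'.2 /\ w.1 = w'.1
    end).

Definition difference_frame (U : Type) : unimodal_frame :=
  @UnimodalFrame U (fun x y => x <> y).

Definition Diff_x_Diff : set form :=
  logic_of [set F | exists U V : Type, [/\ inhabited U, inhabited V
    & F = product_frame (difference_frame U) (difference_frame V)]].

Definition Diff_xsq_Diff : set form :=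
  logic_of [set F | exists U V : Type, [/\ inhabited U, inhabited V,
    [set: U] #= [set: V]
    & F = product_frame (difference_frame U) (difference_frame V)]].

(* Main.v *)
(* For each k, let C_k be the frame on k labels with inequality as horizontal
   relation and the universal vertical relation. It is a bounded morphic image
   of a product with k columns, hence validates Diff x Diff, but it refutes a
   formula (in k variables) valid in all squares: each row of C_k has k points
   while each column contains every label repeatedly, so there are more rows
   than columns. If k > 2^n, a valuation of n variables cannot tell apart some
   two labels of C_k, and then one of them may be repeated within a row; the
   model becomes bisimilar to one on a countably infinite square. So C_k
   validates all n-variable formulas of the logic of squares. *)
Require Import Defs.
From mathcomp Require Import all_boot.
From mathcomp Require Import boolp classical_sets functions cardinality.
From mathcomp Require Import zify.

Local Open Scope classical_set_scope.

(** * Soundness and bisimulation invariance *)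

Lemma sat_subst (F : bimodal_frame) (V : nat -> set F) s f w :
  sat V (subst s f) w <-> sat (fun p => [set x | sat V (s p) x]) f w.
Proof.
elim: f w => //=.
- by move=> f IHf w; rewrite IHf.
- by move=> f IHf g IHg w; rewrite IHf IHg.
- by move=> f IHf g IHg w; rewrite IHf IHg.
- by move=> i f IHf w; split=> H w' /H; rewrite IHf.
- by move=> i f IHf w; split=> -[w' Rw' H]; exists w' => //; apply/IHf.
Qed.

Lemma sat_Imp (F : bimodal_frame) (V : nat -> set F) f g w :
  sat V (Imp f g) w <-> (sat V f w -> sat V g w).
Proof.
split=> /= [[nf /nf//|gw _ //]|fg].
by have [/fg|] := EM (sat V f w); [right|left].
Qed.

Lemma prop_eval_sat (F : bimodal_frame) (V : nat -> set F) w f :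
  prop_eval (fun g => `[< sat V g w >]) f <-> sat V f w.
Proof.
elim: f => //=.
- by move=> p; split=> /asboolP.
- by move=> f IHf; rewrite -IHf; split=> /negP.
- by move=> f IHf g IHg; rewrite -IHf -IHg; split=> /andP.
- by move=> f IHf g IHg; rewrite -IHf -IHg; split=> /orP.
- by move=> i f _; split=> /asboolP.
- by move=> i f _; split=> /asboolP.
Qed.

(** Lets a smallest normal logic be bounded above by the validities of a single frame. *)
Lemma normal_valid (F : bimodal_frame) : normal_logic (valid F).
Proof.
split.
- by move=> f taut V w; apply/prop_eval_sat.
- move=> i p q V w; apply/sat_Imp=> pq; apply/sat_Imp=> Hp w' Rw'.
  exact: (iffLR (sat_Imp F V (Var p) (Var q) w') (pq w' Rw')) (Hp w' Rw').
- by move=> s f Ff V w; apply/sat_subst.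
- by move=> f g Ff Ffg V w; have /sat_Imp := Ffg V w; apply.
- by move=> i f Ff V w w' _; apply: Ff.
Qed.

(** Atoms have to agree only on [S]: bounded morphisms take [setT], the twin argument the variables
    of the formula. *)
Lemma sat_bisim (F G : bimodal_frame) (VF : nat -> set F) (VG : nat -> set G)
    (S : set nat) (Z : F -> G -> Prop) :
  (forall p x y, S p -> Z x y -> VF p x <-> VG p y) ->
  (forall i x y x', Z x y -> bacc i x x' -> exists2 y', bacc i y y' & Z x' y') ->
  (forall i x y y', Z x y -> bacc i y y' -> exists2 x', bacc i x x' & Z x' y') ->
  forall f x y, vars f `<=` S -> Z x y -> sat VF f x <-> sat VG f y.
Proof.
move=> atom forth back; elim=> //=.
- by move=> p x y pS Zxy; apply: atom => //; apply: pS.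
- by move=> f IHf x y fS Zxy; rewrite (IHf x y).
- move=> f IHf g IHg x y; rewrite subUset => -[fS gS] Zxy.
  by rewrite (IHf x y fS Zxy) (IHg x y gS Zxy).
- move=> f IHf g IHg x y; rewrite subUset => -[fS gS] Zxy.
  by rewrite (IHf x y fS Zxy) (IHg x y gS Zxy).
- move=> i f IHf x y fS Zxy; split=> H.
    by move=> y' /(back _ _ _ _ Zxy)[x' /H fx' Zxy']; apply/(IHf x').
  by move=> x' /(forth _ _ _ _ Zxy)[y' /H fy' Zxy']; apply/(IHf x' y').
- move=> i f IHf x y fS Zxy; split=> -[].
    move=> x' /(forth _ _ _ _ Zxy)[y' Ry' Zxy'] fx'.
    by exists y' => //; apply/(IHf x').
  move=> y' /(back _ _ _ _ Zxy)[x' Rx' Zxy'] fy'.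
  by exists x' => //; apply/(IHf x' y').
Qed.

(** * Formulas comparing the numbers of rows and columns *)

Definition big_and (I : finType) (F : I -> form) : form :=
  foldr And Top [seq F i | i <- enum I].

Definition big_or (I : finType) (F : I -> form) : form :=
  foldr Or Bot [seq F i | i <- enum I].

Lemma sat_big_and (F : bimodal_frame) (V : nat -> set F) (I : finType)
    (f : I -> form) w :
  sat V (big_and I f) w <-> forall i, sat V (f i) w.
Proof.
suff H s : sat V (foldr And Top [seq f i | i <- s]) w <->
    {in s, forall i, sat V (f i) w}.
  by rewrite H; split=> fw i *; apply: fw; rewrite ?mem_enum.
elim: s => //= j s ->; split=> [[fj fs] i|fs].
  by rewrite inE => /predU1P[->|/fs].
by split=> [|i si]; apply: fs; rewrite inE ?eqxx ?si ?orbT.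
Qed.

Lemma sat_big_or (F : bimodal_frame) (V : nat -> set F) (I : finType)
    (f : I -> form) w :
  sat V (big_or I f) w <-> exists i, sat V (f i) w.
Proof.
suff H s : sat V (foldr Or Bot [seq f i | i <- s]) w <->
    exists2 i, i \in s & sat V (f i) w.
  by rewrite H; split=> [[i]|[i fi]]; exists i; rewrite ?mem_enum.
elim: s => [|j s IHs] /=; first by split=> // -[].
rewrite IHs; split=> [[fj|[i si fi]]|[i]].
- by exists j; rewrite ?mem_head.
- by exists i; rewrite // inE si orbT.
- by rewrite inE => /predU1P[->|si fi]; [left|right; exists i].
Qed.

Definition exactly (k : nat) (i : 'I_k) : form :=
  big_and _ (fun j : 'I_k => if j == i then Var j else Neg (Var j)).

Arguments exactly [k].

Lemma sat_exactly (F : bimodal_frame) (V : nat -> set F) k (i : 'I_k) w :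
  sat V (exactly i) w <-> forall j : 'I_k, V j w <-> j = i.
Proof.
rewrite sat_big_and; split=> H j; have := H j;
  have [->|/eqP ne] /= := eqVneq j i.
- by move=> Vi; split.
- by move=> NV; split=> [/NV|/ne].
- by move=> ->.
- by move=> -> /ne.
Qed.

(** Imposed along a whole row of a product of difference frames, it makes the columns inject into
    the [k] labels. *)
Definition labelled (k : nat) : form :=
  And (big_or _ (@exactly k))
      (big_and _ (fun i : 'I_k => Imp (exactly i) (Neg (Dia Hor (exactly i))))).

Lemma sat_labelled (F : bimodal_frame) (V : nat -> set F) k w :
  sat V (labelled k) w <->
  (exists i : 'I_k, sat V (exactly i) w) /\
  (forall i : 'I_k, sat V (exactly i) w ->
     forall w', bacc Hor w w' -> ~ sat V (exactly i) w').
Proof.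
have -> : sat V (labelled k) w <-> sat V (big_or _ (@exactly k)) w /\
    sat V (big_and _ (fun i : 'I_k =>
      Imp (exactly i) (Neg (Dia Hor (exactly i))))) w by [].
rewrite sat_big_or sat_big_and; split=> -[ex H]; split=> // i.
  by have /sat_Imp Hi := H i; move=> /Hi {}Hi w' ? ?; apply: Hi; exists w'.
by apply/sat_Imp=> /(H i) Hi [w' /Hi].
Qed.

(* Forces at most [k] columns, and at least [k.+1] rows: the current one and one
   for each label. *)
Definition taller (k : nat) : form :=
  And (And (labelled k) (Box Hor (labelled k)))
      (big_and _ (fun i : 'I_k => Dia Ver (exactly i))).

Lemma sat_taller (F : bimodal_frame) (V : nat -> set F) k w :
  sat V (taller k) w <->
  [/\ sat V (labelled k) w,
      forall w', bacc Hor w w' -> sat V (labelled k) w' &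
      forall i : 'I_k, exists2 w', bacc Ver w w' & sat V (exactly i) w'].
Proof.
have -> : sat V (taller k) w <->
    (sat V (labelled k) w /\
      forall w', bacc Hor w w' -> sat V (labelled k) w') /\
    sat V (big_and _ (fun i : 'I_k => Dia Ver (exactly i))) w by [].
by rewrite sat_big_and; split=> [[[]]|[]].
Qed.

Lemma Diff_xsq_Diff_not_taller k : Diff_xsq_Diff (Neg (taller k)).
Proof.
move=> _ [U [V [_ _ UV ->]]] v [u0 v0].
suff: ~ sat v (taller k) (u0, v0) by [].
move=> /sat_taller[lab0 labR rows].
have lab u : sat v (labelled k) (u, v0).
  by have [->//|/nesym ne] := EM (u = u0); apply: labR.
have /choice[c cP] : forall u, exists i : 'I_k, sat v (exactly i) (u, v0).
  by move=> u; have /sat_labelled[] := lab u.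
have c_inj : injective c.
  move=> u u' cuu'; apply: contrapT => ne.
  have /sat_labelled[_ /(_ _ (cP u) (u', v0))] := lab u.
  by apply; rewrite // cuu'.
have /choice[r rP] : forall i : 'I_k, exists y,
    y <> v0 /\ sat v (exactly i) (u0, y).
  move=> i; have [[x y] /= [/nesym ne <-] fi] := rows i.
  by exists y.
pose h o := if o is Some i then r i else v0.
have h_inj : injective h.
  have r_inj : injective r.
    move=> i j rij; have [_ /sat_exactly ri] := rP i.
    have [_ /sat_exactly rj] := rP j.
    by apply/rj; rewrite -rij; apply/ri.
  move=> [i|] [j|] //=; [by move=> /r_inj-> | by case: (rP i) |].
  by move/esym; case: (rP j).
have [g g_inj] : exists g : V -> U, injective g.
  have /card_eqPle[_ /card_leP[g]] := UV.
  exists (val \o g \o to_setT) => y y' /val_inj/(inj (mem_set I) (mem_set I)).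
  exact: (congr1 val).
(* Rows embed into columns by [g] and columns into labels by [c], so the [k.+1] rows listed by [h]
   would embed into [k] labels. *)
have := leq_card _ (inj_comp c_inj (inj_comp g_inj h_inj)).
by rewrite card_option ltnn.
Qed.

(** * The frames C_k and their validities *)

(* Not ['I_k], whose universe is too large for a world of a [bimodal_frame]. *)
Definition label (k : nat) : Set := {i : nat | i < k}.

(* The bounded morphic image of a product with [k] columns in which each row
   lists the labels bijectively and each column repeats every label. *)
Definition column_collapse (k : nat) : bimodal_frame :=
  @BimodalFrame (label k) (fun i x y => if i is Hor then x <> y else True).

Lemma collapse_taller_sat n : ~ valid (column_collapse n.+1) (Neg (taller n.+1)).
Proof.
pose V (p : nat) : set (column_collapse n.+1) := [set x | p = val x].
have VP (i : 'I_n.+1) x : sat V (exactly i) x <-> val x = i.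
  rewrite sat_exactly; split=> [/(_ (Ordinal (valP x)))[H _]|xi j].
    by rewrite -H.
  by rewrite /V /= xi; split=> [/val_inj|->].
pose x0 : column_collapse n.+1 := exist _ 0 isT.
suff: sat V (taller n.+1) x0 by move=> H /(_ V x0); apply.
have lab x : sat V (labelled n.+1) x.
  apply/sat_labelled; split; first by exists (Ordinal (valP x)); apply/VP.
  by move=> i /VP xi y ne /VP yi; apply/ne/val_inj; rewrite xi.
apply/sat_taller; split=> // i.
by exists (exist _ (val i) (ltn_ord i)) => //; apply/VP.
Qed.

(** The transposition of [x] and [y]; permuting the labels of a row by it lets any column meet any
    label. *)
Definition exchange (T : eqType) (x y z : T) : T :=
  if z == x then y else if z == y then x else z.

Arguments exchange [T].

Lemma exchangel (T : eqType) (x y : T) : exchange x y x = y.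
Proof. by rewrite /exchange eqxx. Qed.

Lemma exchangeK (T : eqType) (x y : T) : involutive (exchange x y).
Proof.
move=> z; rewrite /exchange.
have [->|zx] := eqVneq z x; last have [->|zy] := eqVneq z y.
- by case: eqVneq => //; rewrite eqxx.
- by rewrite eqxx.
- by rewrite (negPf zx) (negPf zy).
Qed.

(** Row [(i, j, b)] lists the labels permuted by the transposition of [i] and [j], so it stays
    bijective, and column [x] meets [y] in the rows [(x, y, b)]. The bit supplies a second copy of
    each row, since a vertical step of the product must leave its row. *)
Lemma collapse_Diff_x_Diff n : Diff_x_Diff `<=` valid (column_collapse n.+1).
Proof.
move=> f Ff V w.
pose U := label n.+1.
pose R := (U * U * bool)%type.
pose P := product_frame (difference_frame U) (difference_frame R).
have Pf : valid P f.
  by apply: Ff; exists U, R; split=> //; do !constructor; exact: w.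
pose g (x : P) : column_collapse n.+1 := exchange x.2.1.1 x.2.1.2 x.1.
have bisim := sat_bisim P (column_collapse n.+1) (fun p => g @^-1` V p) V setT
  (fun x y => g x = y).
apply: (iffLR (bisim _ _ _ f (w, (w, w, true)) w _ _) (Pf _ _)) => //.
- by move=> p x _ _ <-.
- move=> i x _ x' <- Rxx'; exists (g x') => //; case: i Rxx' => //= -[ne e].
  by rewrite /g e => /(can_inj (exchangeK _ _ _)).
- move=> [] [x [[i j] b]] _ y <- /= H.
    exists (exchange i j y, (i, j, b)); last by rewrite /g /= exchangeK.
    by split=> //= xy; apply: H; rewrite /g /= xy exchangeK.
  exists (x, (x, y, ~~ b)); last by rewrite /g /= exchangel.
  by split=> //= -[_ _]; case: (b).
- exact: exchangel.
Qed.

(** * Twin labels and infinite squares *)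

(* Twins [a] and [b] let the label [a] be repeated at will within a row, so that
   the rows can be made infinite. *)
Lemma collapse_square_twins n (S : set nat) f
    (V : nat -> set (column_collapse n.+1)) (a b : label n.+1) w :
  Diff_xsq_Diff f -> vars f `<=` S -> a <> b ->
  (forall p, S p -> V p a <-> V p b) -> sat V f w.
Proof.
move=> Ff fS ab twins.
pose P := product_frame (difference_frame nat) (difference_frame (nat * nat)).
have Pf : valid P f.
  apply: Ff; exists nat, (nat * nat)%type; split=> //.
  by rewrite card_eq_sym; exact: card_nat2.
(* Numbers beyond the labels default to [a], so [a] is the only label repeated within a row. *)
pose r u : label n.+1 := insubd a u.
have r_inj u u' : r u = r u' -> u <> u' -> r u = a.
  rewrite /r /insubd; case: insubP => [x _ <-|//].
  by case: insubP => [y _ <- /= ->|].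
(* Only the residue of [j] acts in row [(i, j)]; its quotient provides infinitely many copies of the
   row. *)
pose g (x : P) : column_collapse n.+1 :=
  r (exchange x.2.1 (x.2.2 %% n.+1) x.1).
have gc u (c : label n.+1) m : g (u, (u, val c + m * n.+1)) = c.
  by rewrite /g /= exchangel addnC modnMDl modn_small ?(valP c) // /r valKd.
pose sim c d := forall p, S p -> V p c <-> V p d.
have bisim := sat_bisim P (column_collapse n.+1) (fun p => g @^-1` V p) V S
  (fun x y => sim (g x) y).
apply: (iffLR (bisim _ _ _ f (0, (0, val w + 0 * n.+1)) w _ _) (Pf _ _)) => //.
- by move=> p x y Sp /(_ p Sp).
- case=> [] x y x' xy; last by exists (g x').
  (* The answer must differ from [y]: take [g x'], or else [g x], which agrees with [y] on [S]; if
     both equal [y], the repeated label is [a] and its twin [b] serves. *)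
  move=> [ne e].
  have [gx'|gx'] := EM (g x' = y); last by exists (g x') => // /esym.
  have [gx|gx] := EM (g x = y); last first.
    by exists (g x); [exact/nesym|rewrite gx' => p Sp; rewrite (xy p Sp)].
  have gx'a : g x' = a.
    apply: (r_inj _ (exchange x.2.1 (x.2.2 %% n.+1) x.1)).
      exact: etrans gx' (esym gx).
    by rewrite e => /(can_inj (exchangeK _ _ _)) /esym.
  exists b; first by rewrite -gx' gx'a.
  by rewrite gx'a.
- move=> [] [u [i j]] y c uy /= yc; last first.
    (* The multiple of [n.+1] selects a copy of the wanted row other than the current row. *)
    have [e|ne] := EM ((i, j) = (u, val c + 0 * n.+1)).
      exists (u, (u, val c + 1 * n.+1)); last by rewrite gc.
      by split=> //=; rewrite e => -[]; lia.
    by exists (u, (u, val c + 0 * n.+1)); [|rewrite gc].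
  (* A point of the current row labelled [d]. If [x c] lies in the current column, then [c] and [y]
     agree on [S], and [x y] replaces it. *)
  pose x (d : label n.+1) : P := (exchange i (j %% n.+1) (val d), (i, j)).
  have gx d : g (x d) = d by rewrite /g /= exchangeK /r valKd.
  have [e|ne] := EM (u = (x c).1); last by exists (x c) => //; rewrite gx.
  have guc : g (u, (i, j)) = c by rewrite e gx.
  exists (x y); last by rewrite gx => p Sp; rewrite -(uy p Sp) guc.
  split=> //= uxy; apply: yc; rewrite -(gx y) -guc.
  by rewrite uxy.
- by rewrite gc.
Qed.

(** Pigeonhole: the variables in [s] admit only [2 ^ size s] patterns of truth values. *)
Lemma twins_exist (s : seq nat) k (V : nat -> set (label k)) :
  2 ^ size s < k ->
  exists a b : label k, a <> b /\ forall p, p \in s -> V p a <-> V p b.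
Proof.
move=> sk; pose pt (i : 'I_k) : label k := exist _ (val i) (ltn_ord i).
pose col i := map_tuple (fun p => `[< V p (pt i) >]) (in_tuple s).
have /injectivePn[i [j ij colij]] : ~~ injectiveb col.
  apply/injectiveP => /leq_card.
  by rewrite card_ord card_tuple card_bool leqNgt sk.
exists (pt i), (pt j); split=> [/(congr1 val)/= /val_inj/eqP|p ps].
  by rewrite (negPf ij).
have /(congr1 val)/eq_in_map/(_ p ps) ij_p := colij.
exact: asbool_eq_equiv.
Qed.

Theorem theorem2p2 :
  ~ exists Sigma : set form,
      finite_set (\bigcup_(f in Sigma) vars f) /\
      Diff_xsq_Diff = smallest normal_logic (Diff_x_Diff `|` Sigma).
Proof.
move=> [Sigma [/finite_seqP[s sP] sq]].
(* Chosen so that the [n.+1] labels outnumber the patterns of the variables of [Sigma]. *)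
pose n := 2 ^ size s.
apply: (@collapse_taller_sat n).
suff sub : Diff_xsq_Diff `<=` valid (column_collapse n.+1).
  exact/sub/Diff_xsq_Diff_not_taller.
rewrite {1}sq; apply: smallest_sub; first exact: normal_valid.
rewrite subUset; split; first exact: collapse_Diff_x_Diff.
move=> f Sf V w.
have [|a [b [ab twins]]] := twins_exist s n.+1 V.
  exact: ltnSn.
apply: (collapse_square_twins _ [set` s] _ _ a b) => //.
  by rewrite sq; apply: sub_gen_smallest; right.
by rewrite -sP; apply: bigcup_sup.
Qed.
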